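(* Let $A\in\mathbb{R}^{n\times n}$ be a $P$-matrix such that $A=D-L-U$, where $D=dI$ with $d>0$, and $L$, $U$ are strictly lower and strictly upper triangular matrices, respectively. Let $q\in\mathbb{R}^n$. For fixed $\alpha>0$ and $\beta\in\mathbb{R}$, consider the splitting $A=M-N$ with $$M=\frac1\alpha(D-\beta L),\qquad N=\frac1\alpha\left\{(1-\alpha)D+(\alpha-\beta)L+\alpha U\right\}.$$ Let $\gamma>0$ and let $\Omega_4$ be chosen such that $\gamma\Omega_4=D$. Let $\Omega_1=\phi_1 I$ and $\Omega_2=\phi_2 L$, where $\phi_1,\phi_2\in\mathbb{R}$. Define $$s_{\alpha,\beta}=\left|\left(1+\frac1\alpha\right)d+\phi_1\right|-\left|\frac{1-\alpha}{\alpha}d+\phi_1\right|,$$ $$r_{\alpha,\beta}=\left|\frac\beta\alpha+\phi_2\right|+1+\left|\frac{\alpha-\beta}{\alpha}-\phi_2\right|.$$ If $$s_{\alpha,\beta}>\rho\left(r_{\alpha,\beta}|L|+2|U|\right),$$ then the relaxed shifted matrix-splitting modulus-based iteration method (with these $M,N,\Omega_1,\Omega_2,\Omega_4,\gamma$) converges to the unique solution of $\operatorname{LCP}(q,A)$ for every initial vector $x^{(0)}\in\mathbb{R}^n$.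
   Context: For $A\in\mathbb{R}^{n\times n}$ and $q\in\mathbb{R}^n$, $\operatorname{LCP}(q,A)$ is the problem of finding $z,w\in\mathbb{R}^n$ with $w=Az+q$, $z\ge 0$, $w\ge 0$, $z^Tw=0$ (inequalities componentwise); $z$ is referred to as the solution. A $P$-matrix is a real square matrix all of whose principal minors are positive. $|X|$ denotes the entrywise absolute value of a matrix or vector $X$, and $\rho(X)$ is the spectral radius. Relaxed shifted matrix-splitting modulus-based iteration method: given a splitting $A=M-N$, matrices $\Omega_1,\Omega_2\in\mathbb{R}^{n\times n}$, $\gamma>0$, a positive diagonal matrix $\Omega_4$ and $x^{(0)}\in\mathbb{R}^n$, compute for $k=0,1,2,\ldots$ $$(M+\Omega_1-\Omega_2+\gamma\Omega_4)x^{(k+1)}=(N+\Omega_1-\Omega_2)x^{(k)}+(\gamma\Omega_4-A)|x^{(k)}|-\gamma q,$$ $$z^{(k+1)}=\frac1\gamma\left(|x^{(k+1)}|+x^{(k+1)}\right).$$ The method ''converges to the unique solution of $\operatorname{LCP}(q,A)$'' means that the coefficient matrix $M+\Omega_1-\Omega_2+\gamma\Omega_4$ is nonsingular (so the iteration is well defined), the sequence $x^{(k)}$ converges, and $z^{(k)}$ converges to the unique solution $z^\ast$ of $\operatorname{LCP}(q,A)$. *)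

(* Defs.v *)
From HB Require Import structures.
From mathcomp Require Import all_boot all_order all_algebra.
From mathcomp Require Import all_classical all_reals all_analysis.
From mathcomp Require Import complex.

Set Implicit Arguments.
Unset Strict Implicit.
Unset Printing Implicit Defensive.

Import Order.TTheory GRing.Theory Num.Theory.
Import numFieldNormedType.Exports.

Local Open Scope classical_set_scope.
Local Open Scope ring_scope.

(* Not to be confused with MathComp-Analysis's [`|X|], the (scalar) max-norm. *)
Definition mxabs (R : realType) (m n : nat) (X : 'M[R]_(m, n)) : 'M[R]_(m, n) :=
  map_mx Num.norm X.

(* The supremum ranges over the finite set of moduli of the complex
   eigenvalues, which is nonempty as soon as n > 0; for n = 0 the value is
   [sup set0 = 0]. *)
Definition spectral_radius (R : realType) (n : nat) (X : 'M[R]_n) : R :=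
  sup [set ComplexField.Normc.normc l | l in
        [set l : R[i] | eigenvalue (map_mx (real_complex R) X) l]].

Definition P_matrix (R : realType) (n : nat) (A : 'M[R]_n) : Prop :=
  forall S : {set 'I_n},
    0 < \det (mxsub (@enum_val _ (mem S)) (@enum_val _ (mem S)) A).

Definition strictly_lower (R : realType) (n : nat) (X : 'M[R]_n) : Prop :=
  forall i j : 'I_n, (i <= j)%N -> X i j = 0.

Definition strictly_upper (R : realType) (n : nat) (X : 'M[R]_n) : Prop :=
  forall i j : 'I_n, (j <= i)%N -> X i j = 0.

Definition positive_diagonal (R : realType) (n : nat) (X : 'M[R]_n) : Prop :=
  is_diag_mx X /\ (forall i : 'I_n, 0 < X i i).

Definition lcp_solution (R : realType) (n : nat) (q : 'cV[R]_n) (A : 'M[R]_n)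
    (z : 'cV[R]_n) : Prop :=
  exists w : 'cV[R]_n,
    [/\ w = A *m z + q, forall i, 0 <= z i 0, forall i, 0 <= w i 0
      & z^T *m w = 0].

Definition rsmm_coef (R : realType) (n : nat)
    (M Omega1 Omega2 Omega4 : 'M[R]_n) (gamma : R) : 'M[R]_n :=
  M + Omega1 - Omega2 + gamma *: Omega4.

Definition rsmm_iterates (R : realType) (n : nat) (A : 'M[R]_n) (q : 'cV[R]_n)
    (M N Omega1 Omega2 Omega4 : 'M[R]_n) (gamma : R)
    (x : nat -> 'cV[R]_n) : Prop :=
  forall k : nat,
    rsmm_coef M Omega1 Omega2 Omega4 gamma *m x k.+1
    = (N + Omega1 - Omega2) *m x k
      + (gamma *: Omega4 - A) *m mxabs (x k) - gamma *: q.

Definition rsmm_z (R : realType) (n : nat) (gamma : R) (x : 'cV[R]_n) :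
    'cV[R]_n :=
  gamma^-1 *: (mxabs x + x).

(* Since the coefficient matrix is required to be nonsingular, there is exactly
   one sequence x satisfying [rsmm_iterates] with a given x 0, so that
   quantifying universally over such sequences is not vacuous. *)
Definition rsmm_converges (R : realType) (n : nat) (A : 'M[R]_n)
    (q : 'cV[R]_n) (M N Omega1 Omega2 Omega4 : 'M[R]_n) (gamma : R)
    (x0 : 'cV[R]_n) : Prop :=
  rsmm_coef M Omega1 Omega2 Omega4 gamma \in unitmx /\
  exists zstar : 'cV[R]_n,
    unique (lcp_solution q A) zstar /\
    (forall x : nat -> 'cV[R]_n,
       x 0%N = x0 ->
       rsmm_iterates A q M N Omega1 Omega2 Omega4 gamma x ->
       (exists xstar : 'cV[R]_n, x k @[k --> \oo] --> xstar) /\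
       rsmm_z gamma (x k.+1) @[k --> \oo] --> zstar).

Definition s_param (R : realType) (d phi1 alpha : R) : R :=
  `|(1 + alpha^-1) * d + phi1| - `|(1 - alpha) / alpha * d + phi1|.

Definition r_param (R : realType) (phi2 alpha beta : R) : R :=
  `|beta / alpha + phi2| + 1 + `|(alpha - beta) / alpha - phi2|.

(* Main.v *)
(** Put [B = r |L| + 2 |U|], a nonnegative matrix with [rho(B) < s].  There is
    [v > 0] with [B v < s v]: the vector [adj (t - B) 1], rescaled by
    [det (t - B)], is positive for large [t]; as [t] decreases to [s] it can only
    stop being positive by passing through a nonnegative vector [y] with
    [B y < t y], but such a [y] is positive.

    The iteration reads
      [(c - b L) x(k+1) = (e + f L + U) x(k) + (L + U) |x(k)| - gamma q]
    with [s = |c| - |e|] and [r = |b| + 1 + |f|].  Hence the differences [x] and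
    [x'] of two iterates and of their successors satisfy
      [(|c| - |b| |L|) |x'| <= (|e| + B - |b| |L|) |x|],
    and forward substitution shows that one step contracts the norm
    [max |x_i| / v_i].  Fixed points of the step correspond to LCP solutions by
    [gamma z = |x| + x], [gamma w = d (|x| - x)], so Banach's theorem gives
    convergence as well as existence and uniqueness of the LCP solution. *)

Require Import Defs.
From HB Require Import structures.
From mathcomp Require Import all_boot all_order all_algebra.
From mathcomp Require Import all_classical all_reals all_analysis.
From mathcomp Require Import complex ring lra.

Set Implicit Arguments.
Unset Strict Implicit.
Unset Printing Implicit Defensive.

Import Order.TTheory GRing.Theory Num.Theory.
Import numFieldNormedType.Exports.
Local Open Scope ring_scope.

(** * Complex eigenvalues and the spectral radius *)

Lemma normc_le_spectral_radius (R : realType) (n : nat) (X : 'M[R]_n) (l : R[i]) :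
  eigenvalue (map_mx (real_complex R) X) l ->
  ComplexField.Normc.normc l <= spectral_radius X.
Proof.
move=> hl; apply: ub_le_sup; last by exists l.
have [rs hrs] := closed_field_poly_normal (char_poly (map_mx (real_complex R) X)).
(* The supremum needs only some upper bound: eigenvalues lie among the roots [rs], and the sum of
   all moduli dominates each. *)
exists (\sum_(r <- rs) ComplexField.Normc.normc r) => _ [m hm <-].
have : m \in rs.
  move: hm; rewrite /= eigenvalue_root_char hrs (monicP (char_poly_monic _)).
  by rewrite scale1r root_prod_XsubC.
have nn (r : R[i]) : 0 <= ComplexField.Normc.normc r.
  by case: r => a b; rewrite sqrtr_ge0.
move=> /(big_rem m) ->/=; rewrite lerDl; exact: sumr_ge0.
Qed.

Lemma spectral_radius_ge0 (R : realType) (n : nat) (X : 'M[R]_n) :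
  0 <= spectral_radius X.
Proof.
have [[l hl]|none] :=
  pselect (exists l, eigenvalue (map_mx (real_complex R) X) l).
  apply: le_trans (normc_le_spectral_radius hl).
  by case: l {hl} => a b; rewrite sqrtr_ge0.
rewrite /spectral_radius sup_out// => -[[_ [l hl _]] _].
by apply: none; exists l.
Qed.

Lemma char_poly_neq0_gt_spectral_radius (R : realType) (n : nat) (X : 'M[R]_n)
    (t : R) :
  spectral_radius X < t -> (char_poly X).[t] != 0.
Proof.
move=> ht; apply/eqP => /rootP rt.
have : eigenvalue (map_mx (real_complex R) X) (real_complex R t).
  by rewrite eigenvalue_root_char -map_char_poly fmorph_root.
move=> /normc_le_spectral_radius; rewrite /= expr0n/= addr0 sqrtr_sqr.
by apply/negP; rewrite -ltNge (lt_le_trans ht)// ler_norm.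
Qed.

(** * Positive strict supersolutions of a nonnegative matrix *)

Section nonnegative_matrix.
Context {R : realType} {n : nat}.
Variable B : 'M[R]_n.
Hypothesis B0 : forall i j, 0 <= B i j.
Implicit Types (t : R) (y : 'cV[R]_n).

Lemma strict_supersolution_gt0 t y : 0 < t -> (forall i, 0 <= y i 0) ->
  (forall i, (B *m y) i 0 < t * y i 0) -> forall i, 0 < y i 0.
Proof.
move=> t0 y0 hy i; rewrite -(pmulr_rgt0 _ t0) (le_lt_trans _ (hy i))// mxE.
by apply: sumr_ge0 => j _; rewrite mulr_ge0.
Qed.

(** Minimum principle: at a least entry [y k 0 < 0], the row sum bound would give
    [(B *m y) k 0 >= t * y k 0]. *)
Lemma supersolution_ge0 t y : (forall i, \sum_j B i j < t) ->
  (forall i, (B *m y) i 0 < t * y i 0) -> forall i, 0 <= y i 0.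
Proof.
move=> ht hy i0; have [k _ hk] := arg_minP (fun i => y i 0) (erefl : xpredT i0).
apply: le_trans (hk i0 isT); rewrite leNgt; apply/negP => yk0.
have := hy k; apply/negP; rewrite -leNgt mxE.
apply: (@le_trans _ _ (\sum_j B k j * y k 0)).
  by rewrite -mulr_suml ler_wnM2r// ltW.
by apply: ler_sum => j _; rewrite ler_wpM2l// hk.
Qed.

(* [t - B] maps this vector to the constant vector [det (t - B) ^ 2]; unlike
   the resolvent, its entries are polynomials in [t]. *)
Let poly_resolvent : 'cV[{poly R}]_n :=
  \adj (char_poly_mx B) *m const_mx (char_poly B).
Let resolvent t : 'cV[R]_n := \col_i (poly_resolvent i 0).[t].

Let resolventE t :
  (t%:M - B) *m resolvent t = const_mx ((char_poly B).[t] ^+ 2).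
Proof.
have -> : t%:M - B = map_mx (horner_eval t) (char_poly_mx B).
  apply/matrixP => i j; rewrite !mxE /horner_eval/= !hornerE.
  by case: (i == j); rewrite ?hornerE ?mulr1n ?mulr0n.
have -> : resolvent t = map_mx (horner_eval t) poly_resolvent.
  by apply/matrixP => i j; rewrite !mxE ord1.
rewrite -map_mxM /poly_resolvent mulmxA mul_mx_adj mul_scalar_mx.
apply/matrixP => i j; rewrite !mxE /horner_eval/=; exact: hornerM.
Qed.

Lemma exists_gt0_lt_scale s : spectral_radius B < s ->
  exists2 v : 'cV[R]_n, (forall i, 0 < v i 0) &
    forall i, (B *m v) i 0 < s * v i 0.
Proof.
move=> hs.
have super t : s <= t -> forall i, (B *m resolvent t) i 0 < t * resolvent t i 0.
  move=> st i; rewrite -subr_gt0.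
  have := congr1 (fun M : 'cV[R]_n => M i 0) (resolventE t).
  rewrite mulmxBl mul_scalar_mx !mxE => ->.
  (* Thanks to the square, a nonzero determinant suffices, whatever its sign. *)
  rewrite exprn_even_gt0//= char_poly_neq0_gt_spectral_radius//.
  exact: lt_le_trans hs st.
exists (resolvent s); last exact: super.
have s0 : 0 < s := le_lt_trans (spectral_radius_ge0 B) hs.
(* [f t > 0] exactly when all entries are positive, while [f t = 0] still forces them to be
   nonnegative. *)
pose f t := \big[Num.min/1]_i (poly_resolvent i 0).[t].
have f_gt0 t : s <= t -> (forall i, 0 <= resolvent t i 0) -> 0 < f t.
  move=> st h; apply/bigmin_gtP; split => // i _.
  have := @strict_supersolution_gt0 t _ (lt_le_trans s0 st) h (super t st) i.
  by rewrite mxE.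
suff fs : 0 < f s by move: fs => /bigmin_gtP[_ fs] i; rewrite mxE fs.
have cf : continuous f.
  rewrite /f; elim: (index_enum _) => [|i r IH] x.
    under eq_fun do rewrite big_nil; exact: cvg_cst.
  under eq_fun do rewrite big_cons.
  apply: (@continuous_min _ _ (horner (poly_resolvent i 0))).
    exact: continuous_horner.
  exact: IH.
(* [T] exceeds every row sum of [B] because [s > 0]. *)
pose T := s + \sum_i \sum_j B i j.
have sT : s <= T by rewrite lerDl sumr_ge0// => i _; rewrite sumr_ge0.
have fT : 0 < f T.
  apply: f_gt0 => //; apply: supersolution_ge0 (super T sT) => i.
  rewrite -[ltLHS]add0r ltr_leD// [leRHS](bigD1 i)//= lerDl sumr_ge0// => k _.
  by rewrite sumr_ge0.
rewrite ltNge; apply/negP => fs.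
have [|c] := @IVT R f s T 0 sT (continuous_subspaceT cf).
  by rewrite ge_min fs/= le_max (ltW fT) orbT.
rewrite in_itv/= => /andP[sc _] fc.
suff : 0 < f c by rewrite fc ltxx.
apply: f_gt0 => // i; rewrite mxE -fc; exact: bigmin_le.
Qed.

End nonnegative_matrix.

(** * Matrix spaces and contractions in a weighted max-norm *)

HB.instance Definition _ (R : realType) (m n : nat) :=
  Uniform_isComplete.Build 'M[R]_(m, n) (@mx_complete R m n).

Lemma cvg_mx (R : realType) (m n : nat) (u : nat -> 'M[R]_(m, n))
    (l : 'M[R]_(m, n)) :
  ((forall i j, u k i j @[k --> \oo] --> l i j) -> u k @[k --> \oo] --> l)%classic.
Proof.
move=> h; apply/cvgrPdist_le => e e0.
have : \forall k \near \oo%classic, forall i j, `|l i j - u k i j| <= e.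
  apply: filter_forall => i; apply: filter_forall => j.
  by have /cvgrPdist_le := h i j; apply.
apply: filterS => k hk; rewrite /Num.norm/= mx_normrE.
by apply: bigmax_le => [|[i j] _]; [exact: ltW|rewrite !mxE hk].
Qed.

Section weighted_contraction.
Context {R : realType} {n : nat}.
Variables (v : 'cV[R]_n) (theta : R) (G : 'cV[R]_n -> 'cV[R]_n).
Hypothesis v_gt0 : forall i, 0 < v i 0.
Hypotheses (theta_ge0 : 0 <= theta) (theta_lt1 : theta < 1).
(** Contraction for [max |x_i| / v_i], stated through upper bounds [t] so that this norm need not be
    constructed. *)
Hypothesis G_contracts : forall (x y : 'cV[R]_n) t,
  (forall i, `|x i 0 - y i 0| <= t * v i 0) ->
  forall i, `|G x i 0 - G y i 0| <= theta * t * v i 0.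

(** Conjugating [G] by this map turns the weighted norm into the max-norm, to which Banach's theorem
    applies. *)
Let scale (x : 'cV[R]_n) : 'cV[R]_n := \col_i (v i 0 * x i 0).
Let unscale (x : 'cV[R]_n) : 'cV[R]_n := \col_i ((v i 0)^-1 * x i 0).

Let scaleK : cancel scale unscale.
Proof.
by move=> x; apply/matrixP => i j; rewrite !mxE ord1 mulKf// gt_eqF.
Qed.

Let unscaleK : cancel unscale scale.
Proof.
by move=> x; apply/matrixP => i j; rewrite !mxE ord1 mulVKf// gt_eqF.
Qed.

Let scale_dist (x y : 'cV[R]_n) i :
  `|scale x i 0 - scale y i 0| = `|x i 0 - y i 0| * v i 0.
Proof. by rewrite !mxE -mulrBr normrM gtr0_norm// mulrC. Qed.

Let coord_le_norm (x : 'cV[R]_n) i : `|x i 0| <= `|x|.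
Proof.
rewrite {2}/Num.norm/= mx_normrE.
exact: (le_bigmax _ (fun ij => `|x ij.1 ij.2|) (i, 0)).
Qed.

Lemma weighted_contraction_fixpoint : exists p, G p = p.
Proof.
pose H := unscale \o G \o scale.
have [] // := @banach_fixed_point R 'cV[R]_n setT [fun of totalfun H].
- exists (NngNum theta_ge0); split => //= -[x y] _ /=.
  rewrite [leLHS]/Num.norm/= mx_normrE; apply: bigmax_le => [|[i j] _].
    by rewrite mulr_ge0.
  rewrite /= ord1 !mxE -mulrBr normrM gtr0_norm ?invr_gt0// mulrC.
  rewrite ler_pdivrMr//; apply: G_contracts => k.
  rewrite scale_dist ler_wpM2r ?(ltW (v_gt0 _))//.
  by have := coord_le_norm (x - y) k; rewrite !mxE.
- by exists 0.
- by move=> p _ hp; exists (scale p); rewrite [in RHS]hp /H/= unscaleK.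
Qed.

Lemma exists_weighted_dist (x y : 'cV[R]_n) :
  exists t, forall i, `|x i 0 - y i 0| <= t * v i 0.
Proof.
exists `|unscale x - unscale y| => i.
rewrite -{1}[x]unscaleK -{1}[y]unscaleK scale_dist ler_wpM2r ?(ltW (v_gt0 _))//.
by have := coord_le_norm (unscale x - unscale y) i; rewrite !mxE.
Qed.

Lemma weighted_contraction_cvg (p : 'cV[R]_n) (x : nat -> 'cV[R]_n) :
  G p = p -> (forall k, x k.+1 = G (x k)) -> (x k @[k --> \oo] --> p)%classic.
Proof.
move=> Gp xS; have [t ht] := exists_weighted_dist p (x 0%N).
have bound k i : `|p i 0 - x k i 0| <= theta ^+ k * t * v i 0.
  elim: k i => [|k IH] i; first by rewrite mul1r.
  by rewrite xS -{1}Gp exprS -(mulrA theta); exact: G_contracts.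
apply: cvg_mx => i j; rewrite ord1; apply/subr_cvg0.
apply/norm_cvg0P.
apply: (@squeeze_cvgr _ _ _ _ (fun=> 0) (fun k => theta ^+ k * t * v i 0)).
- by apply: nearW => k; rewrite normr_ge0/= distrC.
- exact: cvg_cst.
- rewrite -[X in (_ --> X)%classic](mul0r (v i 0)) -[X in X * _](mul0r t).
  by do 2!apply: cvgMr_tmp; apply: cvg_expr; rewrite ger0_norm.
Qed.

(** The constant orbit at [q] must converge to [p]. *)
Lemma weighted_contraction_fixpoint_unique p q : G p = p -> G q = q -> p = q.
Proof.
move=> Gp Gq.
have /cvg_lim <- // := weighted_contraction_cvg Gp (x := fun=> q) (fun=> esym Gq).
by rewrite lim_cst.
Qed.

End weighted_contraction.

(** * The triangular system and its error estimate *)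

Lemma scalar_sub_strictly_lower_unitmx (R : realType) (n : nat) (L : 'M[R]_n) (c b : R) :
  strictly_lower L -> c != 0 -> c%:M - b *: L \in unitmx.
Proof.
move=> hL c0; rewrite unitmxE unitfE det_trig.
  by apply/prodf_neq0 => i _; rewrite !mxE eqxx hL// mulr0 subr0.
apply/is_trig_mxP => i j ij.
by rewrite !mxE hL ?mulr0 ?subr0 ?(ltnW ij)// -val_eqE ltn_eqF.
Qed.

(** Asking for the bound only where [X i j != 0] lets forward substitution use just the rows above
    [i] when [X] is strictly lower triangular. *)
Lemma ler_norm_mulmx_coord (R : realType) (m n : nat) (X : 'M[R]_(m, n))
    (y v : 'cV[R]_n) (t : R) (i : 'I_m) :
  (forall j, X i j != 0 -> `|y j 0| <= t * v j 0) ->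
  `|(X *m y) i 0| <= t * (mxabs X *m v) i 0.
Proof.
move=> h; rewrite !mxE mulr_sumr; apply: le_trans (ler_norm_sum _ _ _) _.
apply: ler_sum => j _; rewrite mxE normrM mulrCA.
have [->|X0] := eqVneq (X i j) 0; first by rewrite normr0 !mul0r.
by rewrite ler_wpM2l ?normr_ge0// h.
Qed.

Section coordinates.
Context {R : realType} {n : nat}.
Implicit Types x y : 'cV[R]_n.

Lemma coordD x y i : (x + y) i 0 = x i 0 + y i 0. Proof. exact: mxE. Qed.

Lemma coordN x i : (- x) i 0 = - x i 0. Proof. exact: mxE. Qed.

Lemma coordZ (a : R) x i : (a *: x) i 0 = a * x i 0. Proof. exact: mxE. Qed.

Lemma coord_abs x i : mxabs x i 0 = `|x i 0|. Proof. exact: mxE. Qed.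

(** Unlike [mxE], these rules keep [*m] folded, so that [lra] and [ring] see entries of products as
    atoms. *)
Definition coordE := (coordD, coordN, coordZ, coord_abs).

End coordinates.

Section error_contraction.
Context {R : realType} {n : nat}.
Variables (L U : 'M[R]_n) (v : 'cV[R]_n) (c b e f : R).
Hypothesis hL : strictly_lower L.
Hypothesis v_gt0 : forall i, 0 < v i 0.
Hypothesis hv : forall i,
  (((`|b| + 1 + `|f|) *: mxabs L + 2%:R *: mxabs U) *m v) i 0
  < (`|c| - `|e|) * v i 0.

(** Here [a] stands for a difference of absolute values: not a function of the error [x], but
    dominated by it. *)
Lemma rsmm_error_contracts : exists2 theta : R, 0 <= theta < 1 &
  forall (x' x a : 'cV[R]_n) (t : R),
    (c%:M - b *: L) *m x' = (e%:M + f *: L + U) *m x + (L + U) *m a ->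
    (forall i, `|a i 0| <= `|x i 0|) ->
    (forall i, `|x i 0| <= t * v i 0) ->
    forall i, `|x' i 0| <= theta * t * v i 0.
Proof.
pose l i := (mxabs L *m v) i 0; pose u i := (mxabs U *m v) i 0.
have absv_ge0 (X : 'M[R]_n) i : 0 <= (mxabs X *m v) i 0.
  by rewrite mxE; apply: sumr_ge0 => j _; rewrite mxE mulr_ge0// ltW.
(* [hv] with the term in [|b|] moved across reads [W i < C i]. *)
pose W i := `|e| * v i 0 + (`|f| + 1) * l i + 2 * u i.
pose C i := `|c| * v i 0 - `|b| * l i.
have W_ge0 i : 0 <= W i.
  by rewrite !addr_ge0 ?mulr_ge0 ?addr_ge0 ?absv_ge0// ltW.
have WC i : W i < C i.
  by have := hv i; rewrite mulmxDl -!scalemxAl !coordE -/(l i) -/(u i) /W /C; lra.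
have C_gt0 i : 0 < C i := le_lt_trans (W_ge0 i) (WC i).
(* The largest ratio is below 1 since there are finitely many rows; the start value covers
   [n = 0]. *)
pose theta := \big[Num.max/0]_i (W i / C i).
have Wtheta i : W i <= theta * C i.
  rewrite -ler_pdivrMr//; exact: (le_bigmax _ (fun i => W i / C i)).
have theta0 : 0 <= theta by apply: bigmax_ge_id.
exists theta.
  rewrite theta0/=; apply/bigmax_ltP; split => // i _.
  by rewrite ltr_pdivrMr// mul1r.
move=> x' x a t eqx' ax xt i; have [k ik] := ubnP (nat_of_ord i).
(* Forward substitution: row [i] of [L] involves only indices [j < i]. *)
elim: k i ik => // k IH i; rewrite ltnS => ik.
have row : c * x' i 0 = b * (L *m x') i 0 + e * x i 0 + f * (L *m x) i 0
    + (U *m x) i 0 + (L *m a) i 0 + (U *m a) i 0.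
  have := congr1 (fun M : 'cV[R]_n => M i 0) eqx'.
  rewrite mulmxBl !mulmxDl -!scalemxAl !mul_scalar_mx.
  by rewrite !coordE; lra.
have Lx' : `|(L *m x') i 0| <= theta * t * l i.
  apply: ler_norm_mulmx_coord => j Lij; apply: IH; rewrite (leq_trans _ ik)//.
  by rewrite ltnNge; apply: contra_neqN Lij => /hL.
have at_ j : `|a j 0| <= t * v j 0 := le_trans (ax j) (xt j).
have t0 : 0 <= t.
  by rewrite -(pmulr_lge0 _ (v_gt0 i)); exact: le_trans (normr_ge0 _) (xt i).
have Lx := ler_norm_mulmx_coord (X := L) (i := i) (fun j _ => xt j).
have Ux := ler_norm_mulmx_coord (X := U) (i := i) (fun j _ => xt j).
have La := ler_norm_mulmx_coord (X := L) (i := i) (fun j _ => at_ j).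
have Ua := ler_norm_mulmx_coord (X := U) (i := i) (fun j _ => at_ j).
have c_gt0 : 0 < `|c|.
  rewrite -(pmulr_lgt0 _ (v_gt0 i)) (lt_le_trans (C_gt0 i))// gerBl.
  by rewrite mulr_ge0// absv_ge0.
rewrite -(ler_pM2l c_gt0) -normrM row.
(* By [W i <= theta * C i], the terms in [|b|] cancel and leave [|c| * (theta * t * v i 0)]. *)
apply: (@le_trans _ _ (`|b| * (theta * t * l i) + t * W i)); last first.
  by have := ler_wpM2l t0 (Wtheta i); rewrite /C; lra.
set y1 := b * _; set y2 := e * _; set y3 := f * _.
set y4 := (U *m x) i 0; set y5 := (L *m a) i 0; set y6 := (U *m a) i 0.
have : `|y1 + y2 + y3 + y4 + y5 + y6|
    <= `|y1| + `|y2| + `|y3| + `|y4| + `|y5| + `|y6|.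
  by do 5!(apply: le_trans (ler_normD _ _) _; rewrite ?lerD2r).
move/le_trans; apply; rewrite !normrM /W.
have := ler_wpM2l (normr_ge0 b) Lx'; have := ler_wpM2l (normr_ge0 f) Lx.
have := ler_wpM2l (normr_ge0 e) (xt i).
move: La Ux Ua; rewrite -/y4 -/y5 -/y6 -/(l i) -/(u i); lra.
Qed.

End error_contraction.

(** * LCP solutions and the modulus equation *)

Section modulus_equation.
Context {R : realType} {n : nat}.
Variables (A : 'M[R]_n) (q : 'cV[R]_n) (d gamma : R).
Hypotheses (d_gt0 : 0 < d) (gamma_gt0 : 0 < gamma).

Let modulus_equation (x : 'cV[R]_n) :=
  A *m (mxabs x + x) + gamma *: q = d *: (mxabs x - x).

Lemma lcp_solution_of_modulus_equation x :
  modulus_equation x -> lcp_solution q A (rsmm_z gamma x).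
Proof.
move=> hx; exists ((gamma^-1 * d) *: (mxabs x - x)).
have abs_ge (y : R) : 0 <= `|y| + y /\ 0 <= `|y| - y.
  by have := ler_norm y; have := ler_norm (- y); rewrite normrN; split; lra.
split.
- rewrite -scalerA -hx scalerDr scalerA mulVf ?gt_eqF// scale1r.
  by rewrite /rsmm_z scalemxAr.
- move=> i; rewrite !coordE mulr_ge0 ?invr_ge0 ?(ltW gamma_gt0)//.
  by have [] := abs_ge (x i 0).
- move=> i; rewrite !coordE !mulr_ge0 ?invr_ge0 ?(ltW gamma_gt0) ?(ltW d_gt0)//.
  by have [] := abs_ge (x i 0).
- apply/matrixP => i j; rewrite !ord1 [LHS]mxE mxE big1// => k _.
  (* Complementarity is [(|y| + y) (|y| - y) = |y|^2 - y^2 = 0]. *)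
  rewrite [_^T _ _]mxE !coordE mulrACA [X in _ * X]mulrC -subr_sqr.
  by rewrite real_normK ?num_real// subrr mulr0.
Qed.

Lemma modulus_equation_of_lcp_solution z :
  lcp_solution q A z -> exists2 x, modulus_equation x & rsmm_z gamma x = z.
Proof.
(* Solving [gamma z = |x| + x] and [gamma w = d (|x| - x)] for [x] gives this half-difference;
   complementarity makes [|x|] the half-sum. *)
move=> [w [wE z0 w0 zw]]; pose x := 2^-1 *: (gamma *: z - (gamma / d) *: w).
have zw0 i : z i 0 * w i 0 = 0.
  have := congr1 (fun M : 'M[R]_1 => M 0 0) zw; rewrite !mxE.
  under eq_bigr do rewrite mxE.
  move=> /eqP; rewrite psumr_eq0 => [|k _]; last by rewrite mulr_ge0.
  by move=> /allP /(_ i (mem_index_enum _)) /eqP.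
have xE i : x i 0 = 2^-1 * (gamma * z i 0 - (gamma / d) * w i 0).
  by rewrite !coordE.
have absx i : `|x i 0| = 2^-1 * (gamma * z i 0 + (gamma / d) * w i 0).
  have gd : 0 < gamma / d by rewrite divr_gt0.
  rewrite xE; move: (zw0 i) => /eqP; rewrite mulf_eq0 => /orP[]/eqP->.
    rewrite !mulr0 sub0r add0r mulrN normrN ger0_norm//.
    by rewrite !mulr_ge0 ?invr_ge0// ltW.
  by rewrite !mulr0 subr0 addr0 ger0_norm// !mulr_ge0 ?invr_ge0// ltW.
clearbody x.
have xD : mxabs x + x = gamma *: z.
  by apply/colP => i; rewrite !coordE absx xE; field; rewrite gt_eqF.
have xB : d *: (mxabs x - x) = gamma *: w.
  by apply/colP => i; rewrite !coordE absx xE; field; rewrite gt_eqF.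
exists x; first by rewrite /modulus_equation xD xB wE scalerDr scalemxAr.
by rewrite /rsmm_z xD scalerA mulVf ?gt_eqF// scale1r.
Qed.

End modulus_equation.

(** * Convergence of the iteration *)

Theorem theorem4p2 (R : realType) (n : nat) (A D L U : 'M[R]_n) (d : R)
    (q : 'cV[R]_n) (alpha beta gamma phi1 phi2 : R)
    (M N Omega1 Omega2 Omega4 : 'M[R]_n)
    (hA : P_matrix A)
    (hd : 0 < d) (hD : D = d%:M)
    (hL : strictly_lower L) (hU : strictly_upper U)
    (hsplit : A = D - L - U)
    (halpha : 0 < alpha)
    (hM : M = alpha^-1 *: (D - beta *: L))
    (hN : N = alpha^-1 *:
                ((1 - alpha) *: D + (alpha - beta) *: L + alpha *: U))
    (hgamma : 0 < gamma)
    (hOmega4_pos : positive_diagonal Omega4)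
    (hOmega4 : gamma *: Omega4 = D)
    (hOmega1 : Omega1 = phi1%:M) (hOmega2 : Omega2 = phi2 *: L)
    (hrho : spectral_radius (r_param phi2 alpha beta *: mxabs L
                             + 2%:R *: mxabs U)
            < s_param d phi1 alpha) :
  forall x0 : 'cV[R]_n,
    rsmm_converges A q M N Omega1 Omega2 Omega4 gamma x0.
Proof.
move=> x0.
pose c := (1 + alpha^-1) * d + phi1; pose e := (1 - alpha) / alpha * d + phi1.
pose b := beta / alpha + phi2; pose f := (alpha - beta) / alpha - phi2.
have alpha_neq0 : alpha != 0 by rewrite gt_eqF.
have coefE : rsmm_coef M Omega1 Omega2 Omega4 gamma = c%:M - b *: L.
  rewrite /rsmm_coef hM hOmega1 hOmega2 hOmega4 hD; apply/matrixP => i j.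
  by rewrite !mxE /c /b; case: (i == j); rewrite ?mulr1n ?mulr0n; field.
have NE : N + Omega1 - Omega2 = e%:M + f *: L + U.
  rewrite hN hOmega1 hOmega2 hD; apply/matrixP => i j.
  by rewrite !mxE /e /f; case: (i == j); rewrite ?mulr1n ?mulr0n; field.
have DAE : gamma *: Omega4 - A = L + U.
  by rewrite hOmega4 hsplit; apply/matrixP => i j; rewrite !mxE; ring.
(* As [L + U = d - A], cancelling here turns the fixed-point equation into
   [(A + d) x = (d - A) |x| - gamma q], the modulus equation. *)
have splitE : c%:M - b *: L = (e%:M + f *: L + U) + A + d%:M.
  rewrite hsplit hD; apply/matrixP => i j; rewrite !mxE /c /b /e /f.
  by case: (i == j); rewrite ?mulr1n ?mulr0n; field.
pose B := r_param phi2 alpha beta *: mxabs L + 2%:R *: mxabs U.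
have B0 i j : 0 <= B i j.
  by rewrite !mxE addr_ge0// mulr_ge0// !addr_ge0.
have [v v_gt0 hv] := exists_gt0_lt_scale B0 hrho.
(* [hv] fits by conversion: [s_param] and [r_param] unfold to [|c| - |e|] and [|b| + 1 + |f|]. *)
have [theta /andP[theta0 theta1] contracts] :=
  rsmm_error_contracts (b := b) (c := c) (e := e) (f := f) hL v_gt0 hv.
have unit_coef : c%:M - b *: L \in unitmx.
  apply: scalar_sub_strictly_lower_unitmx => //; rewrite -normr_gt0.
  have := le_lt_trans (spectral_radius_ge0 B) hrho.
  by rewrite subr_gt0; apply: le_lt_trans.
pose rhs (x : 'cV[R]_n) :=
  (e%:M + f *: L + U) *m x + (L + U) *m mxabs x - gamma *: q.
pose G x := invmx (c%:M - b *: L) *m rhs x.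
have GE x y : (y = G x) <-> ((c%:M - b *: L) *m y = rhs x).
  by rewrite /G; split=> [->|<-]; rewrite ?mulKVmx ?mulKmx.
have G_contracts (x y : 'cV[R]_n) t :
    (forall i, `|x i 0 - y i 0| <= t * v i 0) ->
    forall i, `|G x i 0 - G y i 0| <= theta * t * v i 0.
  move=> xy i; have -> : G x i 0 - G y i 0 = (G x - G y) i 0 by rewrite !coordE.
  (* The term [gamma *: q] cancels in the difference; the reverse triangle inequality bounds the
     absolute values. *)
  apply: (contracts _ (x - y) (mxabs x - mxabs y)) => [|k|k].
  - rewrite mulmxBr (proj1 (GE x _) erefl) (proj1 (GE y _) erefl) /rhs !mulmxBr.
    by apply/colP => k; rewrite !coordE; ring.
  - by rewrite !coordE ler_dist_dist.
  - by rewrite !coordE.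
have fixE x : G x = x <-> A *m (mxabs x + x) + gamma *: q = d *: (mxabs x - x).
  have key : (c%:M - b *: L) *m x - rhs x =
      A *m (mxabs x + x) + gamma *: q - d *: (mxabs x - x).
    rewrite /rhs -DAE hOmega4 hD splitE !mulmxDl !mulNmx !mulmxDr !mul_scalar_mx.
    by apply/colP => k; rewrite !coordE; ring.
  split=> [/esym/GE hx|/eqP hx].
    by apply/eqP; rewrite -subr_eq0 -key hx subrr.
  by apply/esym/GE/eqP; rewrite -subr_eq0 key subr_eq0.
have [p Gp] := weighted_contraction_fixpoint v_gt0 theta0 theta1 G_contracts.
split; first by rewrite coefE.
exists (rsmm_z gamma p); split.
  split; first exact: (lcp_solution_of_modulus_equation hd hgamma (proj1 (fixE p) Gp)).
  (* Any other solution also comes from a fixed point of [G], hence from [p]. *)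
  move=> z /(modulus_equation_of_lcp_solution hd hgamma)[x /fixE Gx <-].
  congr rsmm_z.
  exact: (weighted_contraction_fixpoint_unique v_gt0 theta0 theta1 G_contracts Gp Gx).
move=> x _ hx.
have xS k : x k.+1 = G (x k) by apply/GE; have := hx k; rewrite coefE NE DAE.
have xp := weighted_contraction_cvg v_gt0 theta0 theta1 G_contracts Gp xS.
split; first by exists p.
have xij i j : (x k.+1 i j @[k --> \oo] --> p i j)%classic.
  apply: (cvg_comp (x \o S) (fun y : 'cV[R]_n => y i j)).
    by have := xp; rewrite -cvg_shiftS; apply.
  exact: coord_continuous.
apply: cvg_mx => i j; rewrite /rsmm_z !mxE; under eq_fun do rewrite !mxE.
apply: cvgM; first exact: cvg_cst.
by apply: cvgD => //; apply: cvg_norm.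
Qed.
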